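(* There exists a constant $C>0$, independent of $L\ge1$, such that for any $\mathbf{u}\in\mathbf{V}_L$, $$\|\mathbf{u}\|_{L^2(\Omega_L)}\le C\|\partial_y\mathbf{u}\|_{L^2(\Omega_L)}.$$
   Context: For $L\ge1$, $\Omega_L:=(-L,L)\times(0,1)\subset\mathbb{R}^2$ with points $(x,y)$, and $\mathbf{n}$ is the unit outer normal on $\partial\Omega_L$. $\mathbf{V}_L:=\{\mathbf{v}\in H^1(\Omega_L)^2:\nabla\cdot\mathbf{v}=0,\ \mathbf{v}\cdot\mathbf{n}=0\text{ on }\partial\Omega_L\}$. *)

(* Defs.v *)
From mathcomp Require Export all_boot all_order all_algebra.
From mathcomp Require Export all_classical all_reals all_analysis.

Set Implicit Arguments.
Unset Strict Implicit.
Unset Printing Implicit Defensive.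
Import Order.TTheory GRing.Theory Num.Theory numFieldNormedType.Exports.

Local Open Scope classical_set_scope.
Local Open Scope ring_scope.

Section Sobolev.
Context {R : realType}.
Implicit Types (D : set (R * R)) (u g phi : R * R -> R) (e : R * R).

Definition e_x : R * R := (1, 0).
Definition e_y : R * R := (0, 1).

Definition leb : {measure set (measurableTypeR R) -> \bar R} := @lebesgue_measure R.
Definition area : {measure set (measurableTypeR R * measurableTypeR R) -> \bar R} :=
  (leb \x leb)%E.

Definition L2norm D u : \bar R := ('N[area]_2%:E[EFin \o (u \_ D)])%E.

Definition in_L2 D u := measurable_fun D u /\ (L2norm D u < +oo)%E.

(* C^oo(R^2): a function all of whose iterated partial derivatives are
   everywhere differentiable. *)
Definition smooth phi :=
  forall (s : seq bool) (p : R * R),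
    differentiable (foldr (fun b f => 'D_(if b then e_y else e_x) f) phi s) p.

Definition test_function D phi :=
  [/\ smooth phi, compact (closure [set p | phi p != 0]) &
      closure [set p | phi p != 0] `<=` D].

Definition is_weak_derivative D e u g :=
  forall phi, test_function D phi ->
    \int[area]_(p in D) (u p * 'D_e phi p) =
    - \int[area]_(p in D) (g p * phi p).

Definition H1 D : set (R * R -> R) :=
  [set u | in_L2 D u /\ forall e, e \in [:: e_x; e_y] ->
             exists g, in_L2 D g /\ is_weak_derivative D e u g].

(* The weak derivative is unique only up to a null set; as for [lim], a
   representative is chosen (0 being the value when there is none). *)
Definition weak_derivative D e u : R * R -> R :=
  xget (cst 0) [set g | in_L2 D g /\ is_weak_derivative D e u g].

Definition Omega (L : R) : set (R * R) := `]- L, L[ `*` `]0, 1[.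

Definition boundary (L : R) : set (R * R) := closure (Omega L) `\` Omega L.

(* Integral over the boundary with respect to arc length; the corners have
   measure zero. *)
Definition boundary_integral (L : R) (f : R * R -> \bar R) : \bar R :=
  (\int[leb]_(y in `]0%R, 1%R[) f ((- L)%R, y) +
   \int[leb]_(y in `]0%R, 1%R[) f (L, y) +
   \int[leb]_(x in `](- L)%R, L[) f (x, 0%R) +
   \int[leb]_(x in `](- L)%R, L[) f (x, 1%R))%E.

Definition boundary_ae (L : R) (P : R * R -> Prop) :=
  [/\ {ae leb, forall y, y \in `]0, 1[ -> P (- L, y)},
      {ae leb, forall y, y \in `]0, 1[ -> P (L, y)},
      {ae leb, forall x, x \in `]- L, L[ -> P (x, 0)} &
      {ae leb, forall x, x \in `]- L, L[ -> P (x, 1)}].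

(* The unit outer normal; the value at the four corners is irrelevant. *)
Definition outer_normal (L : R) (p : R * R) : R * R :=
  if p.1 == - L then - e_x else if p.1 == L then e_x
  else if p.2 == 0 then - e_y else if p.2 == 1 then e_y else 0.

(* [g] is the trace of [u]: the trace operator is the continuous extension to
   H^1 (with values in L^2 of the boundary) of the restriction to the boundary
   of functions that are smooth up to the boundary. *)
Definition is_trace (L : R) u g :=
  measurable_fun (boundary L) g /\
  exists phi : nat -> R * R -> R,
  [/\ forall n, smooth (phi n),
      L2norm (Omega L) (phi n \- u) @[n --> \oo] --> 0%E,
      forall e, e \in [:: e_x; e_y] ->
        L2norm (Omega L) ('D_e (phi n) \- weak_derivative (Omega L) e u)
          @[n --> \oo] --> 0%E &
      boundary_integral L (fun p => ((phi n p - g p) ^+ 2)%:E)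
        @[n --> \oo] --> 0%E].

(* Pairs carry the sup norm in the library, hence an explicit dot product. *)
Definition dotp (a b : R * R) : R := a.1 * b.1 + a.2 * b.2.

Definition L2vnorm D (v : R * R -> R * R) : \bar R :=
  L2norm D (fun p => Num.sqrt (dotp (v p) (v p))).

Definition weak_vderivative D e (v : R * R -> R * R) : R * R -> R * R :=
  fun p => (weak_derivative D e (fst \o v) p, weak_derivative D e (snd \o v) p).

Definition divergence D (v : R * R -> R * R) : R * R -> R :=
  fun p => weak_derivative D e_x (fst \o v) p + weak_derivative D e_y (snd \o v) p.

Definition normal_trace_zero (L : R) (v : R * R -> R * R) :=
  exists g : R * R -> R * R,
  [/\ is_trace L (fst \o v) (fst \o g), is_trace L (snd \o v) (snd \o g) &
      boundary_ae L (fun p => dotp (g p) (outer_normal L p) = 0)].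

Definition V (L : R) : set (R * R -> R * R) :=
  [set v | [/\ H1 (Omega L) (fst \o v), H1 (Omega L) (snd \o v),
               {ae area, forall p, Omega L p -> divergence (Omega L) v p = 0} &
               normal_trace_zero L v]].

End Sobolev.

(* Main.v *)
Require Import Defs.
From mathcomp Require Import measurable_realfun lra.

Set Implicit Arguments.
Unset Strict Implicit.
Unset Printing Implicit Defensive.
Import Order.TTheory GRing.Theory Num.Theory numFieldNormedType.Exports.

(* A trace comes with smooth functions phi (for u.1) and psi (for u.2) that
   approximate the components of u in H^1 and on the boundary, so everything is
   estimated on smooth functions and then passed to the limit.  As psi nearly
   vanishes at y = 0, the fundamental theorem of calculus in y bounds psi by
   d_y psi.  For phi, comparing two points on the same vertical line bounds
   phi(x, y) by d_y phi up to the flux, the integral of phi(x, .) over (0, 1).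
   By the divergence theorem on (-L, x) * (0, 1), the flux is controlled by the
   normal traces on the left, bottom and top sides and by the divergence of
   (phi, psi), all of which tend to 0. *)

Local Open Scope classical_set_scope.
Local Open Scope ring_scope.

(** * Measure and integration on the plane *)

Lemma open_measurable_prod (R : realType) (U : set (R * R)) :
  open U -> measurable U.
Proof.
move=> oU.
(* The measurable structure on the plane is generated by rectangles, so [U] is written as a
   countable union of open boxes with rational centres and radii [1/(n+1)]. *)
pose B (q : rat * rat * nat) : set (R * R) :=
  ball (ratr q.1.1 : R) (q.2.+1%:R^-1) `*` ball (ratr q.1.2 : R) (q.2.+1%:R^-1).
have mB q : measurable (B q).
  by apply: measurableX; apply: open_measurable; apply: ball_open.
have -> : U = \bigcup_(q in [set q | B q `<=` U]) B q.
  apply/seteqP; split => [[x y] Uxy|p [q /= BU]]; last exact: BU.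
  have /nbhs_ballP[e /= e0 be] : nbhs (x, y) U by apply: open_nbhs_nbhs; split.
  (* With a radius below [e / 2], a box that contains [(x, y)] stays inside the ball of radius [e]
     around that point. *)
  have [n /= ne] : exists n : nat, (n.+1%:R^-1 : R) < e / 2.
    have /ltr_add_invr[n] : 0 < e / 2 by rewrite divr_gt0.
    by rewrite add0r; exists n.
  have n0 : 0 < (n.+1%:R^-1 : R) by rewrite invr_gt0.
  have P (z : R) : exists q : rat, ball z (n.+1%:R^-1) (ratr q).
    have [r [bz [q _ qr]]] := @dense_rat R (ball z n.+1%:R^-1)
      (ex_intro _ z (ballxx z n0)) (ball_open _ _).
    by exists q; rewrite qr.
  have [q1 h1] := P x; have [q2 h2] := P y.
  exists (q1, q2, n) => /=; last by split => /=; apply: ball_sym.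
  move=> [s t] [/= hs ht]; apply: be; split => /=.
  - have := ball_triangle h1 hs; apply: le_ball.
    by rewrite (le_trans (lerD (ltW ne) (ltW ne)))// -splitr.
  - have := ball_triangle h2 ht; apply: le_ball.
    by rewrite (le_trans (lerD (ltW ne) (ltW ne)))// -splitr.
rewrite bigcup_mkcond; apply: countable_bigcupT_measurable => // q.
by case: ifPn.
Qed.

Lemma continuous_measurable_prod (R : realType) (f : R * R -> R) :
  continuous f -> measurable_fun setT f.
Proof.
move=> cf; apply: (measurability _ (RGenOpens.measurableE R)) => _ [_ [a [b ->]] <-].
rewrite setTI; apply: open_measurable_prod.
by apply: open_comp; [move=> x _; exact: cf|exact: interval_open].
Qed.

(** * Fubini's theorem on measurable rectangles *)

Section fubini_rectangle.
Local Open Scope ereal_scope.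
Context d1 d2 (T1 : measurableType d1) (T2 : measurableType d2) (R : realType).
Variables (m1 : {sigma_finite_measure set T1 -> \bar R})
          (m2 : {sigma_finite_measure set T2 -> \bar R}).
Variables (A : set T1) (B : set T2) (f : T1 * T2 -> \bar R).
Hypotheses (mA : measurable A) (mB : measurable B).

(** Partial integration commutes with extension by 0, which reduces the rectangle to Fubini's
    theorem on the whole product. *)
Let restr1 x : fubini_F m2 (f \_ (A `*` B)) x =
  ((fun x => \int[m2]_(y in B) f (x, y)) \_ A) x.
Proof.
rewrite /fubini_F patchE; case: ifPn => xA.
  rewrite [RHS]integral_mkcond; apply: eq_integral => y _.
  by rewrite !patchE in_setX xA.
by rewrite integral0_eq// => y _; rewrite patchE in_setX (negbTE xA).
Qed.

Let restr2 y : fubini_G m1 (f \_ (A `*` B)) y =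
  ((fun y => \int[m1]_(x in A) f (x, y)) \_ B) y.
Proof.
rewrite /fubini_G patchE; case: ifPn => yB.
  rewrite [RHS]integral_mkcond; apply: eq_integral => x _.
  by rewrite !patchE in_setX yB andbT.
by rewrite integral0_eq// => x _; rewrite patchE in_setX (negbTE yB) andbF.
Qed.

Hypothesis fi : (m1 \x m2).-integrable (A `*` B) f.

Let fi' : (m1 \x m2).-integrable setT (f \_ (A `*` B)).
Proof.
by apply/integrable_restrict => //; [exact: measurableX|rewrite setTI].
Qed.

Lemma fubini_setX1 :
  \int[m1]_(x in A) \int[m2]_(y in B) f (x, y) = \int[m1 \x m2]_(z in A `*` B) f z.
Proof.
rewrite [RHS]integral_mkcond -(integral12_prod_meas1 fi') integral_mkcond.
by apply: eq_integral => x _; rewrite restr1.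
Qed.

Lemma fubini_setX2 :
  \int[m2]_(y in B) \int[m1]_(x in A) f (x, y) = \int[m1 \x m2]_(z in A `*` B) f z.
Proof.
rewrite [RHS]integral_mkcond -(integral21_prod_meas1 fi') integral_mkcond.
by apply: eq_integral => x _; rewrite restr2.
Qed.

Lemma integrable_setX1 : m1.-integrable A (fun x => \int[m2]_(y in B) f (x, y)).
Proof.
have := integrable_fubini_F fi'; rewrite (funext restr1).
by move/(integrable_restrict _ _ measurableT); rewrite setTI; exact.
Qed.

End fubini_rectangle.

(** Cauchy-Schwarz against the constant 1: the integral of [(|f| - c)^2] is a nonnegative quadratic
    polynomial in [c], and its value at the minimiser gives the inequality. *)
Lemma sqr_Rintegral_norm_le d (T : measurableType d) (R : realType)
    (mu : {measure set T -> \bar R}) (D : set T) (f : T -> R) (l : R) :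
  measurable D -> mu D = l%:E -> mu.-integrable D (EFin \o f) ->
  mu.-integrable D (fun x => (f x ^+ 2)%:E) ->
  (\int[mu]_(x in D) `|f x|) ^+ 2 <= l * \int[mu]_(x in D) (f x ^+ 2).
Proof.
move=> mD muD if1 if2.
have if1' : mu.-integrable D (EFin \o (fun x => `|f x|)).
  exact: (integrable_norm if1).
set I1 := \int[mu]_(x in D) `|f x|; set I2 := \int[mu]_(x in D) (f x ^+ 2).
have l0 : 0 <= l by rewrite -lee_fin -muD measure_ge0.
have icst c : mu.-integrable D (EFin \o cst (c : R)).
  apply: measurable_bounded_integrable => //; first by rewrite muD ltry.
  by exists `|c|; split; [exact: num_real|move=> M cM x _ /=; exact: ltW].
have key c : 0 <= I2 - 2 * c * I1 + l * c ^+ 2.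
  have : 0 <= \int[mu]_(x in D) ((`|f x| - c) ^+ 2).
    by apply: Rintegral_ge0 => x _; exact: sqr_ge0.
  have e x : ((`|f x| - c) ^+ 2) = (f x ^+ 2 - 2 * c * `|f x|) + c ^+ 2.
    by rewrite sqrrB real_normK ?num_real//; lra.
  have -> : \int[mu]_(x in D) ((`|f x| - c) ^+ 2) =
      \int[mu]_(x in D) (f x ^+ 2 - 2 * c * `|f x| + c ^+ 2).
    by apply: eq_Rintegral => x _; exact: e.
  have ic : mu.-integrable D (EFin \o (fun x => 2 * c * `|f x|)).
    exact: (integrableZl mD (2 * c) if1').
  have ib : mu.-integrable D (EFin \o (fun x => (f x ^+ 2 - 2 * c * `|f x|))).
    exact: (integrableB mD if2 ic).
  rewrite (RintegralD mD ib (icst (c ^+ 2))).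
  rewrite (RintegralB mD if2 ic) (RintegralZl _ mD if1').
  by rewrite (Rintegral_cst mu mD) muD /= -/I1 -/I2 [c ^+ 2 * _]mulrC.
(* For [l = 0] the polynomial has no minimiser to use, but then [D] is a null set and [I1 = 0]. *)
have [l00|lneq0] := eqVneq l 0.
  suff -> : I1 = 0 by rewrite expr0n/= l00 mul0r.
  rewrite /I1 /Rintegral.
  rewrite (null_set_integral mD) ?muD ?l00//.
  by case/integrableP: if1'.
have lp : 0 < l by rewrite lt_neqAle eq_sym lneq0.
(* [I1 / l], the mean of [|f|], minimises the quadratic. *)
have := key (I1 / l).
rewrite -(ler_pM2l lp) mulr0 => h.
have lK : l * (I1 / l) = I1 by rewrite mulrC divfK.
rewrite -subr_ge0; apply: (le_trans h).
have -> : l * (I2 - 2 * (I1 / l) * I1 + l * (I1 / l) ^+ 2) =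
  l * I2 - 2 * (l * (I1 / l)) * I1 + (l * (I1 / l)) ^+ 2 by lra.
by rewrite lK; lra.
Qed.

(** * Continuous and C1 functions on plane rectangles *)

Section rectangle.
Context {R : realType}.
Implicit Types (f g : R * R -> R) (h : R -> R) (a b c d x y : R).

Lemma continuous_slice1 f x : continuous f -> continuous (fun y => f (x, y)).
Proof.
move=> cf y; apply: (@continuous_comp _ _ _ (fun y => (x, y)) f); last exact: cf.
by apply: (@cvg_pair _ _ _ _ (nbhs x) (nbhs y)); [exact: cvg_cst|exact: cvg_id].
Qed.

Lemma continuous_slice2 f y : continuous f -> continuous (fun x => f (x, y)).
Proof.
move=> cf x; apply: (@continuous_comp _ _ _ (fun x => (x, y)) f); last exact: cf.
by apply: (@cvg_pair _ _ _ _ (nbhs x) (nbhs y)); [exact: cvg_id|exact: cvg_cst].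
Qed.

Lemma continuous_integrable_itv h a b : continuous h ->
  leb.-integrable `]a, b[ (EFin \o h).
Proof.
move=> ch; apply: (@integrableS _ _ _ leb `[a, b]) => //.
  exact: subset_itv_oo_cc.
apply: continuous_compact_integrable; first exact: segment_compact.
exact: continuous_subspaceT.
Qed.

Lemma leb_itv a b : a <= b -> leb `]a, b[%classic = (b - a)%:E.
Proof.
move=> ab; apply: etrans (lebesgue_measure_itv `]a, b[) _; rewrite /= lte_fin.
by case: ltgtP ab => // -> _; rewrite subrr.
Qed.

Lemma area_rectangle a b c d : a <= b -> c <= d ->
  area (`]a, b[ `*` `]c, d[)%classic = ((b - a) * (d - c))%:E.
Proof.
move=> ab cd;
apply: etrans (product_measure1E leb leb
  (measurable_itv `]a, b[) (measurable_itv `]c, d[)) _.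
by rewrite !leb_itv.
Qed.

Lemma continuous_integrable_rectangle f a b c d : a <= b -> c <= d ->
  continuous f -> area.-integrable (`]a, b[ `*` `]c, d[) (EFin \o f).
Proof.
move=> ab cd cf; apply: measurable_bounded_integrable.
- by apply: measurableX; exact: measurable_itv.
- by rewrite area_rectangle// ltry.
- by apply: measurable_funTS; exact: continuous_measurable_prod.
- have cK : compact (`[a, b] `*` `[c, d]).
    by apply: compact_setX; exact: segment_compact.
  have /compact_bounded[M [_ Mf]] :=
    continuous_compact (continuous_subspaceT cf) cK.
  exists M; split; first exact: num_real.
  move=> N MN [x y] /= [/subset_itv_oo_cc xab /subset_itv_oo_cc ycd].
  by apply: Mf => //; exists (x, y).
Qed.

Lemma EFin_Rintegral_itv h a b : continuous h ->
  (\int[leb]_(x in `]a, b[) h x)%:E = (\int[leb]_(x in `]a, b[) (h x)%:E)%E.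
Proof.
move=> ch; rewrite /Rintegral fineK//; apply: integrable_fin_num => //.
exact: continuous_integrable_itv.
Qed.

Lemma Rintegral_rectangle1 f a b c d : a <= b -> c <= d -> continuous f ->
  \int[leb]_(x in `]a, b[) (\int[leb]_(y in `]c, d[) f (x, y)) =
  \int[area]_(p in `]a, b[ `*` `]c, d[) f p.
Proof.
move=> ab cd cf; rewrite /Rintegral; congr fine.
rewrite -(@fubini_setX1 _ _ _ _ _ leb leb `]a, b[%classic `]c, d[%classic (EFin \o f))//.
  by apply: eq_integral => x _; rewrite EFin_Rintegral_itv//; exact: continuous_slice1.
exact: continuous_integrable_rectangle.
Qed.

Lemma Rintegral_rectangle2 f a b c d : a <= b -> c <= d -> continuous f ->
  \int[leb]_(y in `]c, d[) (\int[leb]_(x in `]a, b[) f (x, y)) =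
  \int[area]_(p in `]a, b[ `*` `]c, d[) f p.
Proof.
move=> ab cd cf; rewrite /Rintegral; congr fine.
rewrite -(@fubini_setX2 _ _ _ _ _ leb leb `]a, b[%classic `]c, d[%classic (EFin \o f))//.
  by apply: eq_integral => y _; rewrite EFin_Rintegral_itv//; exact: continuous_slice2.
exact: continuous_integrable_rectangle.
Qed.

Lemma integrable_Rintegral_rectangle f a b c d : a <= b -> c <= d ->
  continuous f ->
  leb.-integrable `]a, b[ (fun x => (\int[leb]_(y in `]c, d[) f (x, y))%:E).
Proof.
move=> ab cd cf.
have := @integrable_setX1 _ _ _ _ _ leb leb `]a, b[%classic `]c, d[%classic (EFin \o f).
move=> /(_ _ _ (continuous_integrable_rectangle ab cd cf)).
move=> /(_ (measurable_itv _) (measurable_itv _)).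
by apply: eq_integrable => // x _; rewrite EFin_Rintegral_itv//; exact: continuous_slice1.
Qed.

(** All that the estimates require of the smooth approximants: they differentiate only once. *)
Definition C1 f := (forall p, differentiable f p) /\
  forall e, e \in [:: e_x; e_y] -> continuous ('D_e f).

(** The empty word in [smooth] gives differentiability of [f]; the one-letter words give
    differentiability, hence continuity, of its two partial derivatives. *)
Lemma smooth_C1 f : smooth f -> C1 f.
Proof.
move=> sf; split=> [p|e]; first exact: (sf [::]).
rewrite !inE => /orP[] /eqP -> p; apply: differentiable_continuous.
- exact: (sf [:: false]).
- exact: (sf [:: true]).
Qed.

Lemma C1_continuous f : C1 f -> continuous f.
Proof. by move=> [df _] p; exact: differentiable_continuous. Qed.

Lemma C1_continuous_x f : C1 f -> continuous (fun p : R * R => 'D_e_x f p : R).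
Proof. by move=> [_]; apply; rewrite inE eqxx. Qed.

Lemma C1_continuous_y f : C1 f -> continuous (fun p : R * R => 'D_e_y f p : R).
Proof. by move=> [_]; apply; rewrite !inE eqxx orbT. Qed.

Lemma Rintegral_derive h h' a b : a <= b ->
  (forall x, is_derive x (1 : R) h (h' x)) -> continuous h' ->
  \int[leb]_(x in `]a, b[) h' x = h b - h a.
Proof.
move=> ab dh ch'.
(* Both sides vanish when [a = b]; the fundamental theorem is applied for [a < b]. *)
have [<-|neq] := eqVneq a b.
  by rewrite subrr set_itvoo0 Rintegral_set0.
have lab : a < b by rewrite lt_neqAle neq ab.
have mh' : measurable_fun `]a, b[ (EFin \o h').
  by apply/measurable_EFinP; apply: measurable_funTS; exact: continuous_measurable_fun.
rewrite /Rintegral /leb -(@integral_itv_bndoo _ a b (EFin \o h') true false)//.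
rewrite (continuous_FTC2 (F := h))//.
- exact: continuous_subspaceT.
- split.
  + by move=> x _; have [] := dh x.
  + apply: cvg_at_right_filter; apply: differentiable_continuous.
    by apply/derivable1_diffP; have [] := dh a.
  + apply: cvg_at_left_filter; apply: differentiable_continuous.
    by apply/derivable1_diffP; have [] := dh b.
- by move=> x _; rewrite derive1E; have [] := dh x.
Qed.

Lemma Rintegral_derive_y f x a b : a <= b -> C1 f ->
  \int[leb]_(y in `]a, b[) 'D_e_y f (x, y) = f (x, b) - f (x, a).
Proof.
move=> ab f1; have [df _] := f1.
apply: (@Rintegral_derive (fun y => f (x, y)) (fun y => 'D_e_y f (x, y))) => //.
  move=> y.
  (* The difference quotient of the slice is that of [f] along [e_y], so the one-variable derivative
     of the slice is ['D_e_y f]. *)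
  have E : (fun t : R =>
      t^-1 *: (((fun y => f (x, y)) \o shift y) (t *: (1 : R)) - f (x, y))) =
      (fun t : R => t^-1 *: ((f \o shift (x, y)) (t *: e_y) - f (x, y))).
    apply/funext => t /=; congr (_ *: (f _ - _)).
    by apply: injective_projections; rewrite /= ?scaler0 ?mulr0 ?add0r.
  split; rewrite /derivable/derive E//.
  exact: (@diff_derivable _ _ _ f (x, y) e_y (df (x, y))).
exact: (continuous_slice1 (C1_continuous_y f1)).
Qed.

Lemma Rintegral_derive_x f y a b : a <= b -> C1 f ->
  \int[leb]_(x in `]a, b[) 'D_e_x f (x, y) = f (b, y) - f (a, y).
Proof.
move=> ab f1; have [df _] := f1.
apply: (@Rintegral_derive (fun x => f (x, y)) (fun x => 'D_e_x f (x, y))) => //.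
  move=> x.
  have E : (fun t : R =>
      t^-1 *: (((fun x => f (x, y)) \o shift x) (t *: (1 : R)) - f (x, y))) =
      (fun t : R => t^-1 *: ((f \o shift (x, y)) (t *: e_x) - f (x, y))).
    apply/funext => t /=; congr (_ *: (f _ - _)).
    by apply: injective_projections; rewrite /= ?scaler0 ?mulr0 ?add0r.
  split; rewrite /derivable/derive E//.
  exact: (@diff_derivable _ _ _ f (x, y) e_x (df (x, y))).
exact: (continuous_slice2 (C1_continuous_x f1)).
Qed.

End rectangle.

(** * Integral inequalities on bounded intervals *)

Section interval.
Context {R : realType}.
Implicit Types (h k : R -> R) (a b c : R).

Lemma continuous_normr (T : topologicalType) (f : T -> R) :
  continuous f -> continuous (fun x => `|f x|).
Proof. by move=> cf x; apply: cvg_norm; exact: cf. Qed.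

Lemma continuous_sqr (T : topologicalType) (f : T -> R) :
  continuous f -> continuous (fun x => f x ^+ 2).
Proof. by move=> cf x; apply: cvgM; exact: cf. Qed.

Lemma Rintegral_itv_cst c a b : a <= b ->
  \int[leb]_(x in `]a, b[) c = c * (b - a).
Proof.
by move=> ab; rewrite (Rintegral_cst leb (measurable_itv _)) leb_itv.
Qed.

Lemma le_Rintegral_itv h k a b : continuous h -> continuous k ->
  (forall x, a < x < b -> h x <= k x) ->
  \int[leb]_(x in `]a, b[) h x <= \int[leb]_(x in `]a, b[) k x.
Proof.
move=> ch ck hk; apply: le_Rintegral => //; exact: continuous_integrable_itv.
Qed.

Lemma normr_Rintegral_itv h a b : continuous h ->
  `|\int[leb]_(x in `]a, b[) h x| <= \int[leb]_(x in `]a, b[) `|h x|.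
Proof.
by move=> ch; apply: le_normr_Rintegral => //; exact: continuous_integrable_itv.
Qed.

Lemma subset_Rintegral_itv h a b c d : continuous h -> (forall x, 0 <= h x) ->
  c <= a -> b <= d ->
  \int[leb]_(x in `]a, b[) h x <= \int[leb]_(x in `]c, d[) h x.
Proof.
move=> ch h0 ca bd; rewrite -lee_fin !EFin_Rintegral_itv//.
apply: ge0_subset_integral => //.
- apply/measurable_EFinP; apply: measurable_funTS.
  exact: continuous_measurable_fun.
- by move=> x _; rewrite lee_fin.
- by apply: subset_itv; rewrite bnd_simp.
Qed.

Lemma sqr_Rintegral_itv_le h a b : a <= b -> continuous h ->
  (\int[leb]_(x in `]a, b[) `|h x|) ^+ 2 <=
  (b - a) * \int[leb]_(x in `]a, b[) h x ^+ 2.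
Proof.
move=> ab ch; apply: sqr_Rintegral_norm_le => //; first exact: leb_itv.
  exact: continuous_integrable_itv.
exact: (continuous_integrable_itv _ _ (continuous_sqr ch)).
Qed.

End interval.

(** * Estimates for smooth functions *)

Section rectangle.
Context {R : realType}.
Implicit Types (f g : R * R -> R) (x y z L : R).

(** The difference is the integral of ['D_e_y f] over the segment between the two points, which is
    then enlarged to the full unit interval. *)
Lemma vertical_variation f x y z : C1 f -> 0 <= y <= 1 -> 0 <= z <= 1 ->
  `|f (x, y) - f (x, z)| <= \int[leb]_(s in `]0, 1[) `|'D_e_y f (x, s)|.
Proof.
move=> f1; wlog zy : y z / z <= y.
  move=> H y01 z01; have [/H|/ltW/H] := leP z y; first exact.
  by rewrite distrC; exact.
move=> /andP[y0 y1] /andP[z0 z1].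
have cy := continuous_slice1 (x := x) (C1_continuous_y f1).
rewrite -(Rintegral_derive_y x zy f1).
apply: (le_trans (normr_Rintegral_itv _ _ cy)).
by apply: subset_Rintegral_itv => //; exact: continuous_normr.
Qed.

(** Vertical variation from the bottom point, followed by Cauchy-Schwarz on an interval of length 1.
    It serves the second component, which is nearly 0 at the bottom. *)
Lemma sqr_vertical_trace f x y : C1 f -> 0 <= y <= 1 ->
  f (x, y) ^+ 2 <=
  2 * f (x, 0) ^+ 2 + 2 * \int[leb]_(s in `]0, 1[) 'D_e_y f (x, s) ^+ 2.
Proof.
move=> f1 y01.
have cy := continuous_slice1 (x := x) (C1_continuous_y f1).
have z01 : 0 <= (0 : R) <= 1 by rewrite lexx ler01.
have := vertical_variation x f1 y01 z01.
have := sqr_Rintegral_itv_le ler01 cy.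
rewrite subr0 mul1r.
set I := \int[leb]_(s in _) `|_|; set J := \int[leb]_(s in _) _.
move=> IJ dI.
have : (f (x, y) - f (x, 0)) ^+ 2 <= I ^+ 2.
  rewrite -(real_normK (num_real (_ - _))).
  by rewrite ler_sqr ?nnegrE ?normr_ge0// (le_trans _ dI).
(* With [a = f (x, y)] and [b = f (x, 0)], the identity [2 b^2 + 2 (a - b)^2 - a^2 = (a - 2 b)^2]
   closes the estimate. *)
by have := sqr_ge0 (f (x, y) - 2 * f (x, 0)); nra.
Qed.

(** Averaging the vertical variation over the second point shows that [f (x, y)] is within the
    integral of [|'D_e_y f|] of its mean on the vertical line. That mean is the flux through the
    line. *)
Lemma vertical_mean f x y : C1 f -> 0 <= y <= 1 ->
  `|f (x, y)| <= \int[leb]_(s in `]0, 1[) `|'D_e_y f (x, s)| +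
                 `|\int[leb]_(s in `]0, 1[) f (x, s)|.
Proof.
move=> f1 y01.
have cf := continuous_slice1 (x := x) (C1_continuous f1).
have cy := continuous_slice1 (x := x) (C1_continuous_y f1).
set I := \int[leb]_(s in _) `|_|; set M := \int[leb]_(s in _) _.
have cc : continuous (fun _ : R => f (x, y)) by move=> ?; exact: cvg_cst.
have cd : continuous (fun s : R => f (x, y) - f (x, s)).
  by move=> s; apply: cvgB; [exact: cvg_cst|exact: cf].
have e : f (x, y) - M = \int[leb]_(s in `]0, 1[) (f (x, y) - f (x, s)).
  rewrite RintegralB//; try exact: continuous_integrable_itv.
  by rewrite Rintegral_itv_cst ?ler01// subr0 mulr1.
have : `|f (x, y) - M| <= I.
  rewrite e; apply: (le_trans (normr_Rintegral_itv _ _ cd)).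
  have -> : I = \int[leb]_(s in `]0, 1[) I.
    by rewrite Rintegral_itv_cst ?ler01// subr0 mulr1.
  apply: le_Rintegral_itv; first exact: continuous_normr.
    by move=> ?; exact: cvg_cst.
  move=> s /andP[/ltW s0 /ltW s1]; apply: vertical_variation => //.
  by rewrite s0.
have := ler_normD (f (x, y) - M) M; rewrite subrK; lra.
Qed.

Lemma measurable_Omega L : measurable (Omega L).
Proof. by apply: measurableX; exact: measurable_itv. Qed.

(** Here [F] and [F0] stand for the fluxes of [f] through the vertical sections at [x] and [- L],
    [G0] and [G1] for the integrals of [g] along the bottom and the top, and [F - F0 + (G1 - G0)]
    for the integral of the divergence. *)
Lemma telescoping_bound (F F0 G0 G1 A B C D : R) :
  `|F0| <= A -> `|G0| <= B -> `|G1| <= C -> `|F - F0 + (G1 - G0)| <= D ->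
  `|F| <= A + B + C + D.
Proof.
rewrite !ler_norml => /andP[? ?] /andP[? ?] /andP[? ?] /andP[? ?].
by apply/andP; split; lra.
Qed.

(** The divergence theorem to the left of the vertical line at [x]: by Fubini, each partial
    derivative is integrated first in its own variable. Enlarging the domains of the absolute values
    afterwards makes the bound uniform in [x]. *)
Lemma flux_bound f g L x : C1 f -> C1 g -> - L <= x <= L ->
  `|\int[leb]_(y in `]0, 1[) f (x, y)| <=
  \int[leb]_(y in `]0, 1[) `|f (- L, y)| +
  \int[leb]_(s in `]- L, L[) `|g (s, 0)| +
  \int[leb]_(s in `]- L, L[) `|g (s, 1)| +
  \int[area]_(p in Omega L) `|'D_e_x f p + 'D_e_y g p|.
Proof.
move=> f1 g1 /andP[Lx xL].
have cf := C1_continuous f1; have cg := C1_continuous g1.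
have cfx := C1_continuous_x f1; have cgy := C1_continuous_y g1.
pose d (p : R * R) : R := 'D_e_x f p + 'D_e_y g p.
have cd : continuous d by move=> p; apply: cvgD; [exact: cfx|exact: cgy].
pose Q : set (R * R) := `]- L, x[ `*` `]0, 1[.
have mQ : measurable Q by apply: measurableX; exact: measurable_itv.
have iQ h : continuous h -> area.-integrable Q (EFin \o h).
  by move=> ch; exact: continuous_integrable_rectangle.
have e1 : \int[area]_(p in Q) 'D_e_x f p =
    \int[leb]_(y in `]0, 1[) f (x, y) - \int[leb]_(y in `]0, 1[) f (- L, y).
  rewrite -(Rintegral_rectangle2 Lx ler01 cfx) -RintegralB//.
  - by apply: eq_Rintegral => y _; rewrite Rintegral_derive_x.
  - exact: (continuous_integrable_itv _ _ (continuous_slice1 cf)).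
  - exact: (continuous_integrable_itv _ _ (continuous_slice1 cf)).
have e2 : \int[area]_(p in Q) 'D_e_y g p =
    \int[leb]_(s in `]- L, x[) g (s, 1) - \int[leb]_(s in `]- L, x[) g (s, 0).
  rewrite -(Rintegral_rectangle1 Lx ler01 cgy) -RintegralB//.
  - by apply: eq_Rintegral => s _; rewrite Rintegral_derive_y.
  - exact: (continuous_integrable_itv _ _ (continuous_slice2 cg)).
  - exact: (continuous_integrable_itv _ _ (continuous_slice2 cg)).
have e3 : \int[area]_(p in Q) d p =
    \int[area]_(p in Q) 'D_e_x f p + \int[area]_(p in Q) 'D_e_y g p.
  by rewrite /d RintegralD//; exact: iQ.
pose D := \int[area]_(p in Omega L) `|d p|.
have dle : `|\int[area]_(p in Q) d p| <= D.
  apply: (le_trans (le_normr_Rintegral _ (iQ _ cd))) => //.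
  have cnd := continuous_normr cd.
  rewrite /Rintegral fine_le//.
  - exact: (integrable_fin_num _ (iQ _ cnd)).
  - apply: integrable_fin_num; first exact: measurable_Omega.
    by apply: continuous_integrable_rectangle => //; exact: (le_trans Lx xL).
  - apply: ge0_subset_integral => //.
    + exact: measurable_Omega.
    + apply/measurable_EFinP; apply: measurable_funTS.
      exact: continuous_measurable_prod.
    + move=> [s t] [/= hs ht]; split => //=.
      by move: hs; apply: subset_itv; rewrite bnd_simp.
have gle t : `|\int[leb]_(s in `]- L, x[) g (s, t)| <=
    \int[leb]_(s in `]- L, L[) `|g (s, t)|.
  have ct := continuous_slice2 (y := t) cg.
  apply: (le_trans (normr_Rintegral_itv _ _ ct)).
  by apply: subset_Rintegral_itv => //; exact: continuous_normr.
have fle := normr_Rintegral_itv 0 1 (continuous_slice1 (x := - L) cf).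
by move: dle; rewrite e3 e2 e1; apply: telescoping_bound.
Qed.

End rectangle.

(** * L2 bounds on the whole domain for C1 functions *)

Section Omega.
Context {R : realType}.
Implicit Types (f g k : R * R -> R) (h : R -> R) (L : R).

(** Integrates in [x] an estimate known on each vertical line: [h] carries the trace or flux term,
    [k] the squared vertical derivative. *)
Lemma le_Rintegral_slices f h k (c L : R) : 0 <= L ->
  continuous f -> continuous h -> continuous k ->
  (forall x, - L <= x <= L -> \int[leb]_(y in `]0, 1[) f (x, y) <=
     h x + c * \int[leb]_(y in `]0, 1[) k (x, y)) ->
  \int[area]_(p in Omega L) f p <=
  \int[leb]_(x in `]- L, L[) h x + c * \int[area]_(p in Omega L) k p.
Proof.
move=> L0 cf ch ck H.
have LL : - L <= L by rewrite ge0_cp.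
rewrite /Omega -!(Rintegral_rectangle1 LL ler01)//.
have if_ := integrable_Rintegral_rectangle LL ler01 cf.
have ik := integrable_Rintegral_rectangle LL ler01 ck.
have ih := continuous_integrable_itv (- L) L ch.
have mI : measurable (`]- L, L[%classic : set (measurableTypeR R)).
  exact: measurable_itv.
have ick := integrableZl mI c ik.
rewrite -(RintegralZl c mI ik) -(RintegralD mI ih ick).
apply: le_Rintegral => //.
  exact: (integrableD mI ih ick).
by move=> x /=; rewrite in_itv/= => /andP[/ltW Lx /ltW xL]; apply: H; rewrite Lx.
Qed.

Lemma L2_bound_of_trace g L : 0 <= L -> C1 g ->
  \int[area]_(p in Omega L) g p ^+ 2 <=
  2 * \int[leb]_(x in `]- L, L[) g (x, 0) ^+ 2 +
  2 * \int[area]_(p in Omega L) 'D_e_y g p ^+ 2.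
Proof.
move=> L0 g1; have cg := C1_continuous g1; have cgy := C1_continuous_y g1.
have ct := continuous_sqr (continuous_slice2 (y := 0) cg).
have mI : measurable (`]- L, L[%classic : set (measurableTypeR R)).
  exact: measurable_itv.
rewrite -(RintegralZl 2 mI (continuous_integrable_itv (- L) L ct)).
apply: le_Rintegral_slices => //.
- exact: continuous_sqr.
- by move=> x; apply: cvgMr; exact: ct.
- exact: (continuous_sqr cgy).
move=> x _; set B := (X in _ <= X).
(* The bound is independent of [y], so it equals its own integral over the unit interval and the
   comparison becomes pointwise in [y]. *)
have -> : B = \int[leb]_(s in `]0, 1[) B.
  by rewrite Rintegral_itv_cst ?ler01// subr0 mulr1.
apply: le_Rintegral_itv.
- exact: (continuous_sqr (continuous_slice1 cg)).
- by move=> ?; exact: cvg_cst.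
- by move=> y /andP[/ltW y0 /ltW y1]; apply: sqr_vertical_trace; rewrite ?y0.
Qed.

Lemma sqr_add_le (a b : R) : (a + b) ^+ 2 <= 2 * a ^+ 2 + 2 * b ^+ 2.
Proof. by have := sqr_ge0 (a - b); nra. Qed.

Lemma sqr_add4_le (a b c d A B C D : R) :
  a ^+ 2 <= A -> b ^+ 2 <= B -> c ^+ 2 <= C -> d ^+ 2 <= D ->
  (a + b + c + d) ^+ 2 <= 4 * (A + B + C + D).
Proof.
move=> aA bB cC dD.
have := sqr_add_le (a + b + c) d; have := sqr_add_le (a + b) (c + d).
by have := sqr_add_le a b; have := sqr_add_le c d; rewrite -addrA; lra.
Qed.

(** The vertical mean gives [f^2 <= 2 I^2 + 2 M^2], where [I] is the integral of [|'D_e_y f|] over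
    the line and [M] the flux. The flux bound gives [M^2 <= 4 S], with [S] the parenthesised sum,
    and integrating [8 S] over a length [2 L] yields [16 L S]. The factors [2 L] inside [S] come
    from Cauchy-Schwarz on sets of measure [2 L]. They are harmless: every term of [S] tends to 0
    along the approximation. *)
Lemma L2_bound_of_flux f g L : 0 <= L -> C1 f -> C1 g ->
  \int[area]_(p in Omega L) f p ^+ 2 <=
  2 * \int[area]_(p in Omega L) 'D_e_y f p ^+ 2 +
  16 * L * (\int[leb]_(y in `]0, 1[) f (- L, y) ^+ 2 +
    2 * L * \int[leb]_(s in `]- L, L[) g (s, 0) ^+ 2 +
    2 * L * \int[leb]_(s in `]- L, L[) g (s, 1) ^+ 2 +
    2 * L * \int[area]_(p in Omega L) ('D_e_x f p + 'D_e_y g p) ^+ 2).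
Proof.
move=> L0 f1 g1.
have LL : - L <= L by rewrite ge0_cp.
have cf := C1_continuous f1; have cg := C1_continuous g1.
have cfx := C1_continuous_x f1; have cfy := C1_continuous_y f1.
have cgy := C1_continuous_y g1.
pose d (p : R * R) : R := 'D_e_x f p + 'D_e_y g p.
have cd : continuous d by move=> p; apply: cvgD; [exact: cfx|exact: cgy].
pose A := \int[leb]_(y in `]0, 1[) f (- L, y) ^+ 2.
pose B := \int[leb]_(s in `]- L, L[) g (s, 0) ^+ 2.
pose C := \int[leb]_(s in `]- L, L[) g (s, 1) ^+ 2.
pose D := \int[area]_(p in Omega L) d p ^+ 2.
rewrite -/A -/B -/C; change (\int[area]_(p in Omega L) (_ + _) ^+ 2) with D.
pose S := A + 2 * L * B + 2 * L * C + 2 * L * D; rewrite -/S.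
have dLL : L - - L = 2 * L by rewrite opprK mulr_natl mulr2n.
have flux x : - L <= x <= L ->
    (\int[leb]_(y in `]0, 1[) f (x, y)) ^+ 2 <= 4 * S.
  move=> Lx; have := flux_bound f1 g1 Lx.
  set a := \int[leb]_(y in _) `|_|; set b := \int[leb]_(s in _) `|_|.
  set c := \int[leb]_(s in _) `|g (s, 1)|.
  pose e := \int[area]_(p in Omega L) `|d p|.
  change (\int[area]_(p in _) _) with e => h.
  have aA : a ^+ 2 <= A.
    have := sqr_Rintegral_itv_le ler01 (continuous_slice1 (x := - L) cf).
    by rewrite subr0 mul1r.
  have bB : b ^+ 2 <= 2 * L * B.
    have := sqr_Rintegral_itv_le LL (continuous_slice2 (y := 0) cg).
    by rewrite dLL.
  have cC : c ^+ 2 <= 2 * L * C.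
    have := sqr_Rintegral_itv_le LL (continuous_slice2 (y := 1) cg).
    by rewrite dLL.
  have eD : e ^+ 2 <= 2 * L * D.
    apply: sqr_Rintegral_norm_le.
    - exact: measurable_Omega.
    - by rewrite area_rectangle ?ler01// dLL subr0 mulr1.
    - exact: continuous_integrable_rectangle.
    - apply: (continuous_integrable_rectangle LL ler01 (continuous_sqr cd)).
  apply: le_trans (sqr_add4_le aA bB cC eD).
  rewrite -(real_normK (num_real (\int[leb]_(y in _) _))).
  by rewrite ler_sqr ?nnegrE ?normr_ge0// (le_trans _ h).
rewrite addrC.
have -> : 16 * L * S = \int[leb]_(x in `]- L, L[) (8 * S).
  by rewrite Rintegral_itv_cst// dLL; lra.
apply: le_Rintegral_slices => //.
- exact: (continuous_sqr cf).
- by move=> ?; exact: cvg_cst.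
- exact: (continuous_sqr cfy).
move=> x xL; set B' := (X in _ <= X).
have -> : B' = \int[leb]_(s in `]0, 1[) B'.
  by rewrite Rintegral_itv_cst ?ler01// subr0 mulr1.
apply: le_Rintegral_itv.
- exact: (continuous_sqr (continuous_slice1 cf)).
- by move=> ?; exact: cvg_cst.
move=> y /andP[/ltW y0 /ltW y1].
have y01 : 0 <= y <= 1 by rewrite y0.
rewrite -(real_normK (num_real (f (x, y)))).
have cfyx := continuous_slice1 (x := x) cfy.
have := sqr_Rintegral_itv_le ler01 cfyx; rewrite subr0 mul1r.
have := vertical_mean x f1 y01; have := flux x xL; rewrite /B'.
set M := \int[leb]_(y in _) f (x, y); set I := \int[leb]_(s in _) `|_|.
set J := \int[leb]_(s in _) _ ^+ 2.
rewrite -(real_normK (num_real M)) => MS fI IJ.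
have : `|f (x, y)| ^+ 2 <= (I + `|M|) ^+ 2.
  by rewrite ler_sqr ?nnegrE ?normr_ge0// (le_trans _ fI).
move=> /le_trans; apply; apply: (le_trans (sqr_add_le _ _)).
have -> : 8 * S = 2 * (4 * S) by rewrite mulrA -natrM.
by rewrite addrC lerD// ler_pM2l.
Qed.

End Omega.

(** * Passage to the limit *)

(** The integral of a nonnegative function is a supremum over the simple functions below it, hence
    monotone whether or not [f] and [g] are measurable. *)
Lemma ge0_le_integral_nonmeasurable d (T : measurableType d) (R : realType)
    (mu : {measure set T -> \bar R}) (D : set T) (f g : T -> \bar R) :
  (forall x, D x -> 0 <= f x)%E -> (forall x, D x -> f x <= g x)%E ->
  (\int[mu]_(x in D) f x <= \int[mu]_(x in D) g x)%E.
Proof.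
move=> f0 fg; have g0 x : D x -> (0 <= g x)%E.
  by move=> Dx; rewrite (le_trans (f0 x Dx))// fg.
rewrite !ge0_integralE//; apply: ge_ereal_sup => _ [h /= hf <-].
apply: ereal_sup_ubound; exists h => //= x.
apply: (le_trans (hf x)); rewrite !patchE; case: ifPn => // xD.
by apply: fg; exact: set_mem.
Qed.

(** * Squared L2 norms *)

Section energy.
Context {R : realType}.
Implicit Types (D : set (R * R)) (f g h : R * R -> R).

(** Squaring [L2norm] postpones roots to the very end and lets the two components of a field simply
    add up. *)
Definition energy D f : \bar R := (\int[area]_(p in D) (f p ^+ 2)%:E)%E.

Lemma energy_ge0 D f : (0 <= energy D f)%E.
Proof. by apply: integral_ge0 => p _; rewrite lee_fin sqr_ge0. Qed.

Lemma sqr_L2norm D f : (L2norm D f `^ 2 = energy D f)%E.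
Proof.
rewrite /L2norm poweR_Lnorm ?pnatr_eq0// /energy [RHS]integral_mkcond.
apply: eq_integral => p _ /=.
rewrite powR_mulrn// !patchE; case: ifPn => _.
  by rewrite real_normK ?num_real.
by rewrite normr0 expr0n.
Qed.

Lemma L2norm_energy D f : L2norm D f = (energy D f `^ 2^-1)%E.
Proof.
rewrite -sqr_L2norm -poweRrM mulfV ?pnatr_eq0// poweRe1//.
exact: Lnorm_ge0.
Qed.

Lemma le_L2norm D f g (c : R) : 0 <= c ->
  (energy D f <= (c ^+ 2)%:E * energy D g)%E ->
  (L2norm D f <= c%:E * L2norm D g)%E.
Proof.
move=> c0 fg; rewrite !L2norm_energy.
have -> : c%:E = ((c ^+ 2)%:E `^ 2^-1)%E.
  by rewrite poweR_EFin powR12_sqrt ?sqr_ge0// sqrtr_sqr ger0_norm.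
rewrite -poweRM ?lee_fin ?sqr_ge0//; last exact: energy_ge0.
apply: gt0_ler_poweR => //; rewrite in_itv/= leey andbT.
- exact: energy_ge0.
- by rewrite mule_ge0 ?lee_fin ?sqr_ge0//; exact: energy_ge0.
Qed.

Lemma energy_lty D f : (L2norm D f < +oo)%E -> (energy D f < +oo)%E.
Proof. by move=> fy; rewrite -sqr_L2norm poweR_lty. Qed.

Lemma in_L2_energyE D f : in_L2 D f ->
  energy D f = (fine (energy D f))%:E.
Proof.
by move=> [_ fy]; rewrite fineK// ge0_fin_numE ?energy_ge0// energy_lty.
Qed.

Lemma energy_cvg0_near D (f_ : nat -> R * R -> R) (e : R) : 0 < e ->
  L2norm D (f_ n) @[n --> \oo] --> 0%E ->
  \forall n \near \oo, (energy D (f_ n) <= e%:E)%E.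
Proof.
move=> e0 f0.
have se : 0 < Num.sqrt e by rewrite sqrtr_gt0.
have : \forall n \near \oo, (L2norm D (f_ n) < (Num.sqrt e)%:E)%E.
  have N0 : nbhs (0 : \bar R) [set x | x < (Num.sqrt e)%:E]%E.
    by apply: open_ereal_lt'; rewrite lte_fin.
  exact: (f0 _ N0).
apply: filterS => n fn; rewrite -sqr_L2norm.
have -> : e%:E = ((Num.sqrt e)%:E `^ 2)%E.
  by rewrite poweR_EFin powR_mulrn ?sqrtr_ge0// sqr_sqrtr// ltW.
apply: gt0_ler_poweR => //; rewrite ?in_itv/= ?leey ?andbT ?lee_fin ?sqrtr_ge0//.
- exact: Lnorm_ge0.
- exact: ltW.
Qed.

Lemma measurable_sqr D f : measurable_fun D f ->
  measurable_fun D (fun p => (f p ^+ 2)%:E).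
Proof. by move=> mf; apply/measurable_EFinP; exact: measurable_funX. Qed.

(** The pointwise hypothesis is only almost everywhere because the divergence of [u] vanishes only
    in that sense. *)
Lemma energy_le D f g h (a b : R) : measurable D ->
  measurable_fun D f -> measurable_fun D g -> measurable_fun D h ->
  (energy D g <= a%:E)%E -> (energy D h <= b%:E)%E ->
  {ae area, forall p, D p -> f p ^+ 2 <= 2 * g p ^+ 2 + 2 * h p ^+ 2} ->
  (energy D f <= (2 * a + 2 * b)%:E)%E.
Proof.
move=> mD mf mg mh ga hb fgh.
have mg2 := measurable_sqr mg; have mh2 := measurable_sqr mh.
have m2 k : measurable_fun D (fun p => (k p ^+ 2)%:E) ->
    measurable_fun D (fun p => 2%:E * (k p ^+ 2)%:E)%E.
  by move=> mk; exact: measurable_funeM.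
have p2 k p : (0 <= 2%:E * ((k p : R) ^+ 2)%:E)%E.
  by rewrite -EFinM lee_fin mulr_ge0// sqr_ge0.
apply: (@le_trans _ _ (\int[area]_(p in D)
    (2%:E * (g p ^+ 2)%:E + 2%:E * (h p ^+ 2)%:E))%E).
  apply: ae_ge0_le_integral => //.
  - by move=> p _; rewrite lee_fin sqr_ge0.
  - exact: measurable_sqr.
  - by move=> p _; rewrite adde_ge0.
  - by apply: emeasurable_funD; exact: m2.
rewrite ge0_integralD//; [|exact: m2|exact: m2].
rewrite !ge0_integralZl_EFin//;
  try by move=> p _; rewrite lee_fin sqr_ge0.
by rewrite (EFinD (2 * a)) (EFinM 2 a) (EFinM 2 b) leeD// lee_pmul2l.
Qed.

Lemma continuous_energy f (L : R) : 0 <= L -> continuous f ->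
  energy (Omega L) f = (\int[area]_(p in Omega L) f p ^+ 2)%:E.
Proof.
move=> L0 cf; rewrite /Rintegral fineK//.
apply: integrable_fin_num; first exact: measurable_Omega.
apply: (continuous_integrable_rectangle _ ler01 (continuous_sqr cf)).
by rewrite ge0_cp.
Qed.

End energy.
Arguments energy {R} D%_classical_set_scope f%_ring_scope.

(** * Traces on the sides and their normal components *)

Section trace.
Context {R : realType}.
Implicit Types (u g f : R * R -> R) (L : R).

(** Off a measurable null set [k] vanishes and the two integrands agree. Since [k] carries no
    measurability, the comparison goes through the monotonicity valid for arbitrary nonnegative
    functions. *)
Lemma sqr_trace_le (h k : R -> R) (a b e : R) : continuous h ->
  {ae leb, forall x, x \in `]a, b[ -> k x = 0} ->
  (\int[leb]_(x in `]a, b[) ((h x - k x) ^+ 2)%:E <= e%:E)%E ->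
  \int[leb]_(x in `]a, b[) h x ^+ 2 <= e.
Proof.
move=> ch [N [mN N0 kN]] hk; rewrite -lee_fin EFin_Rintegral_itv; last first.
  exact: continuous_sqr.
apply: le_trans hk; rewrite (ge0_negligible_integral mN) => //.
- rewrite integral_mkcond [leRHS]integral_mkcond.
  apply: ge0_le_integral_nonmeasurable => x _.
    by apply: erestrict_ge0 => y _; rewrite lee_fin sqr_ge0.
  rewrite !patchE in_setD; case: ifPn => [/andP[xab xN]|_].
    rewrite xab (_ : k x = 0) ?subr0//; apply: contrapT => kx.
    move: xN; rewrite notin_setE; apply; apply: kN => /= H; apply: kx; apply: H.
    by move: xab; rewrite inE.
  by case: ifPn; rewrite // lee_fin sqr_ge0.
- apply/measurable_EFinP; apply: measurable_funTS.
  by apply: continuous_measurable_fun; exact: continuous_sqr.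
- by move=> x _; rewrite lee_fin sqr_ge0.
Qed.

Lemma summands_le_adde4 (A B C D : \bar R) :
  (0 <= A -> 0 <= B -> 0 <= C -> 0 <= D ->
  [/\ A <= A + B + C + D, C <= A + B + C + D & D <= A + B + C + D])%E.
Proof.
move=> A0 B0 C0 D0; split.
- by rewrite -!addeA leeDl// !adde_ge0.
- by rewrite -addeA addeCA leeDl// !adde_ge0.
- by rewrite leeDr// !adde_ge0.
Qed.

(** The sides contribute nonnegative terms, so each is at most the whole boundary integral. The
    three sides listed are those that enter [flux_bound]. *)
Lemma boundary_cvg0_near L (f_ : nat -> R * R -> R) (e : R) : 0 < e ->
  boundary_integral L (fun p => (f_ n p ^+ 2)%:E) @[n --> \oo] --> 0%E ->
  \forall n \near \oo,
  [/\ (\int[leb]_(y in `]0%R, 1%R[) (f_ n (- L, y) ^+ 2)%:E <= e%:E)%E,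
      (\int[leb]_(x in `](- L)%R, L[) (f_ n (x, 0) ^+ 2)%:E <= e%:E)%E &
      (\int[leb]_(x in `](- L)%R, L[) (f_ n (x, 1) ^+ 2)%:E <= e%:E)%E].
Proof.
move=> e0 f0.
have N0 : nbhs (0 : \bar R) [set x | x < e%:E]%E.
  by apply: open_ereal_lt'; rewrite lte_fin.
have : \forall n \near \oo,
    (boundary_integral L (fun p => (f_ n p ^+ 2)%:E) < e%:E)%E.
  exact: (f0 _ N0).
apply: filterS => n /ltW; rewrite /boundary_integral.
have pos (a b : R) (h : R -> R) :
    (0 <= \int[leb]_(x in `]a, b[) (h x ^+ 2)%:E)%E.
  by apply: integral_ge0 => x _; rewrite lee_fin sqr_ge0.
have := pos 0 1 (fun y => f_ n (- L, y)); have := pos 0 1 (fun y => f_ n (L, y)).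
have := pos (- L) L (fun y => f_ n (y, 0)).
have := pos (- L) L (fun y => f_ n (y, 1)).
move=> D0 C0 B0 A0 H.
by have [h1 h2 h3] := summands_le_adde4 A0 B0 C0 D0; split; exact: le_trans H.
Qed.

Lemma dotp_outer_normal_left L (v : R * R) y :
  dotp v (outer_normal L (- L, y)) = - v.1.
Proof. by rewrite /dotp /outer_normal /= eqxx /= oppr0 mulr0 addr0 mulrN1. Qed.

(** Strict membership makes both tests on the first coordinate in [outer_normal] fail, so the normal
    there is [- e_y]. *)
Lemma dotp_outer_normal_bottom L (v : R * R) x : x \in `]- L, L[ ->
  dotp v (outer_normal L (x, 0)) = - v.2.
Proof.
rewrite in_itv/= => /andP[Lx xL].
rewrite /dotp /outer_normal /= (gt_eqF Lx) (lt_eqF xL) eqxx /=.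
by rewrite oppr0 mulr0 add0r mulrN1.
Qed.

Lemma dotp_outer_normal_top L (v : R * R) x : x \in `]- L, L[ ->
  dotp v (outer_normal L (x, 1)) = v.2.
Proof.
rewrite in_itv/= => /andP[Lx xL].
rewrite /dotp /outer_normal /= (gt_eqF Lx) (lt_eqF xL) oner_eq0 eqxx /=.
by rewrite mulr0 add0r mulr1.
Qed.

Lemma sqr_le_sub (a b : R) : a ^+ 2 <= 2 * b ^+ 2 + 2 * (a - b) ^+ 2.
Proof. by have := sqr_add_le b (a - b); rewrite addrC subrK. Qed.

End trace.

(** * Exchange between L2 functions and their continuous approximants *)

Section approximation.
Context {R : realType}.
Variables (L d : R).
Hypothesis L0 : 0 <= L.

Let measurable_continuous (f : R * R -> R) : continuous f -> measurable_fun (Omega L) f.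
Proof. by move=> cf; apply: measurable_funTS; exact: continuous_measurable_prod. Qed.

(** From the limit to the approximant; used on the vertical derivatives. *)
Lemma continuous_energy_le (f w : R * R -> R) (a : R) :
  measurable_fun (Omega L) w -> continuous f ->
  (energy (Omega L) w <= a%:E)%E -> (energy (Omega L) (f \- w) <= d%:E)%E ->
  \int[area]_(p in Omega L) f p ^+ 2 <= 2 * a + 2 * d.
Proof.
move=> mw cf wa fw; rewrite -lee_fin -(continuous_energy L0 cf).
have mf := measurable_continuous cf.
apply: (energy_le (measurable_Omega L) mf mw (measurable_funB mf mw) wa fw).
by apply: aeW => p _; exact: sqr_le_sub.
Qed.

(** From the approximant back to the limit; used on the components of [u]. *)
Lemma energy_le_continuous (f w : R * R -> R) :
  measurable_fun (Omega L) w -> continuous f ->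
  (energy (Omega L) (f \- w) <= d%:E)%E ->
  (energy (Omega L) w <=
    (2 * \int[area]_(p in Omega L) f p ^+ 2 + 2 * d)%:E)%E.
Proof.
move=> mw cf fw; have mf := measurable_continuous cf.
have ff : (energy (Omega L) f <= (\int[area]_(p in Omega L) f p ^+ 2)%:E)%E.
  by rewrite (continuous_energy L0 cf).
apply: (energy_le (measurable_Omega L) mw mf (measurable_funB mf mw) ff fw).
by apply: aeW => p _ /=; rewrite -(opprB (w p)) sqrrN; exact: sqr_le_sub.
Qed.

(** Where [w1 + w2 = 0], the sum [f1 + f2] is the sum of the two approximation errors. Applied to
    the derivatives in the divergence, it shows that the approximants are nearly divergence free. *)
Lemma continuous_energy_sum_le (f1 f2 w1 w2 : R * R -> R) :
  measurable_fun (Omega L) w1 -> measurable_fun (Omega L) w2 ->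
  continuous f1 -> continuous f2 ->
  {ae area, forall p, Omega L p -> w1 p + w2 p = 0} ->
  (energy (Omega L) (f1 \- w1) <= d%:E)%E ->
  (energy (Omega L) (f2 \- w2) <= d%:E)%E ->
  \int[area]_(p in Omega L) (f1 p + f2 p) ^+ 2 <= 4 * d.
Proof.
move=> mw1 mw2 cf1 cf2 w12 fw1 fw2.
have cf : continuous (fun p => f1 p + f2 p).
  by move=> p; apply: cvgD; [exact: cf1|exact: cf2].
have mf1 := measurable_continuous cf1; have mf2 := measurable_continuous cf2.
rewrite -lee_fin -(continuous_energy L0 cf).
have -> : 4 * d = 2 * d + 2 * d by lra.
apply: (energy_le (measurable_Omega L) (measurable_continuous cf)
  (measurable_funB mf1 mw1) (measurable_funB mf2 mw2) fw1 fw2).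
apply: (@filterS _ _ (ae_filter_ringOfSetsType area) _ _ _ w12) => p H Op.
have -> : f1 p + f2 p = (f1 p - w1 p) + (f2 p - w2 p).
  by rewrite addrACA -opprD H// subr0.
exact: sqr_add_le.
Qed.

End approximation.

(** Bookkeeping for the first component: [r], [p] and [q] are the squared norms of [phi], of its
    vertical derivative and of the approximate divergence, and the [b]s are boundary terms. The
    factor of [a] is [2 * 2 * 2]: two exchanges with the limit and the factor of [p]. *)
Lemma flux_error_le (R : realType) (L d a r p q b0 b1 b2 : R) :
  0 <= L -> 0 <= d -> b0 <= d -> b1 <= d -> b2 <= d ->
  p <= 2 * a + 2 * d -> q <= 4 * d ->
  r <= 2 * p + 16 * L * (b0 + 2 * L * b1 + 2 * L * b2 + 2 * L * q) ->
  2 * r + 2 * d <= 8 * a + d * (10 + 32 * L + 384 * L ^+ 2).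
Proof.
move=> L0 d0 h0 h1 h2 hp hq hr.
have L2 : 0 <= 2 * L by rewrite mulr_ge0.
have g1 : 2 * L * b1 <= 2 * L * d by rewrite ler_wpM2l.
have g2 : 2 * L * b2 <= 2 * L * d by rewrite ler_wpM2l.
have gq : 2 * L * q <= 2 * L * (4 * d) by rewrite ler_wpM2l.
have L16 : 0 <= 16 * L by rewrite mulr_ge0.
have : 16 * L * (b0 + 2 * L * b1 + 2 * L * b2 + 2 * L * q) <=
  16 * L * (d + 2 * L * d + 2 * L * d + 2 * L * (4 * d)).
  by rewrite ler_wpM2l// !lerD.
lra.
Qed.

Lemma trace_error_le (R : realType) (d a r q b1 : R) :
  b1 <= d -> q <= 2 * a + 2 * d -> r <= 2 * b1 + 2 * q ->
  2 * r + 2 * d <= 8 * a + 14 * d.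
Proof. by move=> *; lra. Qed.

(** Picks the accuracy [d] for which the errors of both components add up to exactly [e]. *)
Lemma error_split (R : realType) (L e : R) : 0 <= L -> 0 < e ->
  exists2 d, 0 < d & e = d * (10 + 32 * L + 384 * L ^+ 2) + 14 * d.
Proof.
move=> L0 e0; pose K := 24 + 32 * L + 384 * L ^+ 2.
have K0 : 0 < K by have := sqr_ge0 L; rewrite /K; lra.
exists (e / K); first by rewrite divr_gt0.
have eK : e / K * K = e by rewrite divfK// gt_eqF.
by rewrite -[LHS]eK /K; lra.
Qed.

(** Membership in [H1] makes the set of candidates nonempty, so [xget] returns a genuine weak
    derivative and not its default [cst 0]. *)
Lemma in_L2_weak_derivative (R : realType) (D : set (R * R)) (f : R * R -> R) e :
  e \in [:: e_x; e_y] -> H1 D f -> in_L2 D (weak_derivative D e f).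
Proof.
move=> he [_ /(_ e he)[g gP]]; rewrite /weak_derivative.
by case: xgetP => [h _ [] //|/(_ g)].
Qed.

(** * The estimate for fields in [V L] *)

Section limit.
Context {R : realType}.
Variables (L : R) (u : R * R -> R * R).
Hypotheses (L1 : 1 <= L) (uV : V L u).

Let W e := weak_derivative (Omega L) e.

Let L0 : 0 <= L. Proof. exact: le_trans L1. Qed.

(** The normal is horizontal on the left side and vertical on the bottom and top, so a vanishing
    normal trace makes [phi] small on the former and [psi] small on the latter. *)
Let approximation (d : R) : 0 < d -> exists phi psi : R * R -> R,
  [/\ C1 phi /\ C1 psi,
      (energy (Omega L) (phi \- (fst \o u)) <= d%:E)%E /\
      (energy (Omega L) (psi \- (snd \o u)) <= d%:E)%E,
      (energy (Omega L) ('D_e_y phi \- W e_y (fst \o u)) <= d%:E)%E /\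
      (energy (Omega L) ('D_e_y psi \- W e_y (snd \o u)) <= d%:E)%E,
      (energy (Omega L) ('D_e_x phi \- W e_x (fst \o u)) <= d%:E)%E &
      [/\ \int[leb]_(y in `]0, 1[) phi (- L, y) ^+ 2 <= d,
          \int[leb]_(x in `]- L, L[) psi (x, 0) ^+ 2 <= d &
          \int[leb]_(x in `]- L, L[) psi (x, 1) ^+ 2 <= d]].
Proof.
move=> d0; have ex : (e_x : R * R) \in [:: e_x; e_y] by rewrite inE eqxx.
have ey : (e_y : R * R) \in [:: e_x; e_y] by rewrite !inE eqxx orbT.
have [_ _ _ [g [[_ [phi [sphi phiu dphiu phig]]]
  [_ [psi [spsi psiu dpsiu psig]]] [gl _ gb gt]]]] := uV.
have [n [[p1 p2 p3] [p4 p5] [p6 _ _] [_ p7 p8]]] : exists n,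
  [/\ [/\ (energy (Omega L) (phi n \- (fst \o u)) <= d%:E)%E,
      (energy (Omega L) ('D_e_x (phi n) \- W e_x (fst \o u)) <= d%:E)%E &
      (energy (Omega L) ('D_e_y (phi n) \- W e_y (fst \o u)) <= d%:E)%E],
      (energy (Omega L) (psi n \- (snd \o u)) <= d%:E)%E /\
      (energy (Omega L) ('D_e_y (psi n) \- W e_y (snd \o u)) <= d%:E)%E,
    [/\ (\int[leb]_(y in `]0%R, 1%R[)
           ((phi n (- L, y) - (fst \o g) (- L, y)) ^+ 2)%:E <= d%:E)%E,
        (\int[leb]_(x in `](- L)%R, L[)
           ((phi n (x, 0) - (fst \o g) (x, 0)) ^+ 2)%:E <= d%:E)%E &
        (\int[leb]_(x in `](- L)%R, L[)
           ((phi n (x, 1) - (fst \o g) (x, 1)) ^+ 2)%:E <= d%:E)%E] &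
    [/\ (\int[leb]_(y in `]0%R, 1%R[)
           ((psi n (- L, y) - (snd \o g) (- L, y)) ^+ 2)%:E <= d%:E)%E,
        (\int[leb]_(x in `](- L)%R, L[)
           ((psi n (x, 0) - (snd \o g) (x, 0)) ^+ 2)%:E <= d%:E)%E &
        (\int[leb]_(x in `](- L)%R, L[)
           ((psi n (x, 1) - (snd \o g) (x, 1)) ^+ 2)%:E <= d%:E)%E]].
  have h1 := energy_cvg0_near d0 phiu.
  have h2 := energy_cvg0_near d0 (dphiu _ ex).
  have h3 := energy_cvg0_near d0 (dphiu _ ey).
  have h4 := energy_cvg0_near d0 psiu.
  have h5 := energy_cvg0_near d0 (dpsiu _ ey).
  have h6 := boundary_cvg0_near (f_ := fun n => phi n \- (fst \o g)) d0 phig.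
  have h7 := boundary_cvg0_near (f_ := fun n => psi n \- (snd \o g)) d0 psig.
  (* Seven conditions that each hold for all large [n] hold together at some [n], which serves both
     sequences. *)
  have [n [q1 [q2 [q3 [q4 [q5 [q6 q7]]]]]]] := filter_ex (filterI h1 (filterI h2
    (filterI h3 (filterI h4 (filterI h5 (filterI h6 h7)))))).
  exists n; split; [split; [exact: q1|exact: q2|exact: q3]|
    split; [exact: q4|exact: q5]|exact: q6|exact: q7].
have phi1 := smooth_C1 (sphi n); have psi1 := smooth_C1 (spsi n).
exists (phi n), (psi n).
split; [exact: conj|exact: conj|exact: conj|exact: p2|split].
- apply: sqr_trace_le p6; first exact: continuous_slice1 (C1_continuous phi1).
  apply: (@filterS _ _ (ae_filter_ringOfSetsType leb) _ _ _ gl) => y H /H.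
  by rewrite dotp_outer_normal_left => /eqP; rewrite oppr_eq0 => /eqP.
- apply: sqr_trace_le p7; first exact: continuous_slice2 (C1_continuous psi1).
  apply: (@filterS _ _ (ae_filter_ringOfSetsType leb) _ _ _ gb) => x H xL; move: (H xL).
  by rewrite dotp_outer_normal_bottom// => /eqP; rewrite oppr_eq0 => /eqP.
- apply: sqr_trace_le p8; first exact: continuous_slice2 (C1_continuous psi1).
  apply: (@filterS _ _ (ae_filter_ringOfSetsType leb) _ _ _ gt) => x H xL; move: (H xL).
  by rewrite dotp_outer_normal_top.
Qed.

Lemma energy_bound : (energy (Omega L) (fst \o u) + energy (Omega L) (snd \o u) <=
  8%:E * (energy (Omega L) (W e_y (fst \o u)) + energy (Omega L) (W e_y (snd \o u))))%E.
Proof.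
have ex : (e_x : R * R) \in [:: e_x; e_y] by rewrite inE eqxx.
have ey : (e_y : R * R) \in [:: e_x; e_y] by rewrite !inE eqxx orbT.
have [H1u H2u div0 _] := uV.
have [mu1 _] := H1u.1; have [mu2 _] := H2u.1.
have [mx1 _] := in_L2_weak_derivative ex H1u.
have w1 := in_L2_weak_derivative ey H1u; have my1 := w1.1.
have w2 := in_L2_weak_derivative ey H2u; have my2 := w2.1.
pose a1 := fine (energy (Omega L) (W e_y (fst \o u))).
pose a2 := fine (energy (Omega L) (W e_y (snd \o u))).
have a1E : energy (Omega L) (W e_y (fst \o u)) = a1%:E := in_L2_energyE w1.
have a2E : energy (Omega L) (W e_y (snd \o u)) = a2%:E := in_L2_energyE w2.
clearbody a1 a2.
(* An arbitrary [e > 0] absorbs the approximation error. The accuracy [d] depends on [L], whereas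
   the factor 8 does not: this is what makes the final constant uniform. *)
rewrite a1E a2E -EFinD -EFinM; apply/lee_addgt0Pr => e e0.
have [d d0 ->] := error_split L0 e0.
have [phi [psi [[f1 g1] [phiu psiu] [phiy psiy] phix [b0 b1 b2]]]] := approximation d0.
have cf := C1_continuous f1; have cg := C1_continuous g1.
have cfx := C1_continuous_x f1; have cfy := C1_continuous_y f1.
have cgy := C1_continuous_y g1.
have hp : \int[area]_(p in Omega L) 'D_e_y phi p ^+ 2 <= 2 * a1 + 2 * d.
  by apply: (continuous_energy_le L0 my1 cfy) phiy; rewrite a1E.
have hq : \int[area]_(p in Omega L) 'D_e_y psi p ^+ 2 <= 2 * a2 + 2 * d.
  by apply: (continuous_energy_le L0 my2 cgy) psiy; rewrite a2E.
have hd := continuous_energy_sum_le L0 mx1 my2 cfx cgy div0 phix psiy.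
have f2 := L2_bound_of_flux L0 f1 g1.
have g2 := L2_bound_of_trace L0 g1.
have u1 := energy_le_continuous L0 mu1 cf phiu.
have u2 := energy_le_continuous L0 mu2 cg psiu.
apply: (le_trans (leeD u1 u2)); rewrite -!EFinD lee_fin.
have k1 := flux_error_le L0 (ltW d0) b0 b1 b2 hp hd f2.
have k2 := trace_error_le b1 hq g2.
by apply: (le_trans (lerD k1 k2)); rewrite (mulrDr 8) addrACA.
Qed.

End limit.

Lemma energy_norm (R : realType) (D : set (R * R)) (v : R * R -> R * R) :
  measurable D -> measurable_fun D (fst \o v) -> measurable_fun D (snd \o v) ->
  energy D (fun p => Num.sqrt (dotp (v p) (v p))) =
  (energy D (fst \o v) + energy D (snd \o v))%E.
Proof.
move=> mD m1 m2; rewrite /energy -ge0_integralD//.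
- apply: eq_integral => p _; rewrite -EFinD /dotp -!expr2 sqr_sqrtr//.
  by rewrite addr_ge0 ?sqr_ge0.
- by move=> p _; rewrite lee_fin sqr_ge0.
- exact: measurable_sqr.
- by move=> p _; rewrite lee_fin sqr_ge0.
- exact: measurable_sqr.
Qed.

Theorem lemma3p3 (R : realType) :
  exists C : R, 0 < C /\
    forall L : R, 1 <= L -> forall u : R * R -> R * R, V L u ->
      (L2vnorm (Omega L) u <=
       C%:E * L2vnorm (Omega L) (weak_vderivative (Omega L) e_y u))%E.
Proof.
(* The energies satisfy the bound with factor 8, and [8 <= 4 ^ 2]. *)
exists 4; split=> [|L L1 u uV]; first exact: ltr0n.
have mO := measurable_Omega L.
have [H1u H2u _ _] := uV.
have ey : (e_y : R * R) \in [:: e_x; e_y] by rewrite !inE eqxx orbT.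
have [m1 _] := in_L2_weak_derivative ey H1u.
have [m2 _] := in_L2_weak_derivative ey H2u.
apply: le_L2norm; first exact: ler0n.
rewrite (energy_norm mO H1u.1.1 H2u.1.1).
rewrite (energy_norm (v := weak_vderivative (Omega L) e_y u) mO m1 m2).
apply: (le_trans (energy_bound L1 uV)).
apply: lee_wpmul2r; first by apply: adde_ge0; exact: energy_ge0.
by rewrite lee_fin; lra.
Qed.
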